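(* Let $D=\prod_{i=1}^d[u_{\min,i},u_{\max,i}]\subset\mathbb{R}^d$ (with $d\ge 1$ and $u_{\min,i}<u_{\max,i}$), let $\omega$ be a probability measure on $D$ that is absolutely continuous with respect to Lebesgue measure, and let $V\subset L^2_\omega(D)$ be a finite-dimensional space of real polynomials in $d$ variables, $\dim V=N\ge 1$. Let $\mathbf f=(f_1,\dots,f_d):D\to\mathbb{R}^d$ be Lipschitz continuous with constant $L_f>0$, i.e. $$\|\mathbf f(\mathbf u_1)-\mathbf f(\mathbf u_2)\|_2\le L_f\|\mathbf u_1-\mathbf u_2\|_2\qquad\text{for all }\mathbf u_1,\mathbf u_2\in D,$$ and let $\tilde{\mathbf f}=(\tilde f_1,\dots,\tilde f_d)$ with $\tilde f_\ell\in V$ for $\ell=1,\dots,d$. Let $\mathbf u(t)$ and $\mathbf x(t)$ be solutions on $[t_0,T]$ of $$\frac{d\mathbf u}{dt}=\mathbf f(\mathbf u),\qquad \frac{d\mathbf x}{dt}=\tilde{\mathbf f}(\mathbf x),\qquad \mathbf x(t_0)=\mathbf u(t_0)\in D,$$ and assume that $\mathbf x(t),\mathbf u(t)\in D$ for all $t_0\le t\le T$. Then for all $t\in[t_0,T]$, $$\|\mathbf x(t)-\mathbf u(t)\|_2\le (t-t_0)\,\|\tilde{\mathbf f}-\mathbf f\|_{2,L^\infty}+L_f\int_{t_0}^t\|\mathbf x(s)-\mathbf u(s)\|_2\,ds,$$ and furthermore $$\|\mathbf x(t)-\mathbf u(t)\|_2\le L_f^{-1}\big(e^{L_f(t-t_0)}-1\big)\Big(\|\mathbf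 f-\mathcal P_V\mathbf f\|_{2,L^\infty}+\|\tilde{\mathbf f}-\mathcal P_V\mathbf f\|_{2,L^2_\omega}\,\|\sqrt K\|_{L^\infty}\Big).$$
   Context: $\|\cdot\|_2$ is the Euclidean norm on $\mathbb{R}^d$. The inner product on $L^2_\omega(D)$ is $(g,h)_{L^2_\omega}=\int_D g\,h\,d\omega$, with induced norm $\|\cdot\|_{L^2_\omega}$. For a scalar function on $D$, $\|\cdot\|_{L^\infty}$ is the essential supremum norm over $D$ (with respect to Lebesgue measure). For a vector-valued function $\mathbf h=(h_1,\dots,h_d):D\to\mathbb{R}^d$, $$\|\mathbf h\|_{2,L^\infty}:=\big\|\,\|\mathbf h(\cdot)\|_2\,\big\|_{L^\infty},\qquad \|\mathbf h\|_{2,L^2_\omega}:=\Big(\sum_{\ell=1}^d\|h_\ell\|_{L^2_\omega}^2\Big)^{1/2}.$$ $\mathcal P_V$ denotes the component-wise orthogonal projection onto $V$: $\mathcal P_V\mathbf f=(\mathcal P_Vf_1,\dots,\mathcal P_Vf_d)$, where $\mathcal P_Vf_\ell$ is the $L^2_\omega$-orthogonal projection of $f_\ell$ onto $V$. $K$ is the diagonal of the reproducing kernel of $V\subset L^2_\omega(D)$: $K(\mathbf x)=\sum_{j=1}^N\psi_j^2(\mathbf x)$ for any basis $\{\psi_j\}_{j=1}^N$ of $V$ that is orthonormal in $L^2_\omega(D)$ (this is independent of the choice of orthonormal basis). *)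

(* Defs.v *)
From HB Require Import structures.
From mathcomp Require Import all_boot all_order all_algebra.
From mathcomp Require Import all_classical all_reals all_analysis.
(* Its notations clash with those of the analysis library. *)
From mathcomp Require Import (canonicals) mpoly.

Set Implicit Arguments.
Unset Strict Implicit.
Unset Printing Implicit Defensive.

Import Order.TTheory GRing.Theory Num.Theory.
Import numFieldNormedType.Exports.

Local Open Scope classical_set_scope.
Local Open Scope ring_scope.

Definition coord_rV {R : realType} n (i : 'I_n) (x : 'rV[R]_n) :
  measurableTypeR R := x ord0 i.

Definition measure_rV_display : measure_display.
Proof. exact: default_measure_display. Qed.

Section measurable_rV.
Context {R : realType} (n : nat).

Let rV_set0 : g_sigma_preimage (@coord_rV R n) set0.
Proof. exact: sigma_algebra0. Qed.

Let rV_setC A : g_sigma_preimage (@coord_rV R n) A ->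
  g_sigma_preimage (@coord_rV R n) (~` A).
Proof. exact: sigma_algebraC. Qed.

Let rV_bigcup (F : (set 'rV[R]_n)^nat) :
  (forall i, g_sigma_preimage (@coord_rV R n) (F i)) ->
  g_sigma_preimage (@coord_rV R n) (\bigcup_i (F i)).
Proof. exact: sigma_algebra_bigcup. Qed.

(* The sigma-algebra generated by the coordinates, i.e. the Borel one. *)
HB.instance Definition _ :=
  @isMeasurable.Build measure_rV_display
    'rV[R]_n (g_sigma_preimage (@coord_rV R n)) rV_set0 rV_setC rV_bigcup.

Lemma measurable_coord_rV (i : 'I_n) :
  measurable_fun [set: 'rV[R]_n] (coord_rV i).
Proof.
move=> _ Y mY; rewrite setTI; apply: sub_sigma_algebra => /=.
rewrite -bigcup_seq/=; exists i => /=; first by rewrite mem_index_enum.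
by exists Y => //; rewrite setTI.
Qed.

Lemma measurable_fun_rV d (T : measurableType d) (g : T -> 'rV[R]_n) :
  (forall i, measurable_fun [set: T] (coord_rV i \o g)) ->
  measurable_fun [set: T] g.
Proof.
move=> mg _ A mA; rewrite setTI.
suff : @measurable _ 'rV[R]_n `<=` [set A | measurable (g @^-1` A)] by exact.
apply: smallest_sub.
  split => /=.
  - by rewrite preimage_set0.
  - by move=> B mB; rewrite setTD -preimage_setC; exact: measurableC.
  - by move=> F mF; rewrite preimage_bigcup; exact: bigcup_measurable.
move=> B; rewrite -bigcup_seq/= => -[i _ [C mC <-]] /=.
by rewrite setTI -comp_preimage -[X in measurable X]setTI; exact: mg.
Qed.

End measurable_rV.

Section lebesgue_measure_rV.
Context {R : realType}.

Definition cons_rV n (p : measurableTypeR R * 'rV[R]_n) : 'rV[R]_n.+1 :=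
  row_mx (p.1%:M : 'rV[R]_1) p.2.

Lemma measurable_cons_rV n : measurable_fun setT (@cons_rV n).
Proof.
apply: measurable_fun_rV => i.
rewrite (_ : _ \o _ = fun p : measurableTypeR R * 'rV[R]_n =>
  match @fintype.split 1 n i with
  | inl _ => p.1 | inr k => coord_rV k p.2 end); last first.
  apply/funext => p; rewrite /coord_rV /cons_rV /= mxE.
  by case: (@fintype.split 1 n i) => //= j; rewrite !ord1 mxE eqxx mulr1n.
case: (@fintype.split 1 n i) => [_|k]; first exact: measurable_fst.
by apply: measurableT_comp; [exact: measurable_coord_rV|exact: measurable_snd].
Qed.

HB.instance Definition _ n :=
  isMeasurableFun.Build _ _ _ _ (@cons_rV n) (@measurable_cons_rV n).

Section step.
Context (n : nat) (mu : {sigma_finite_measure set 'rV[R]_n -> \bar R}).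
Local Open Scope ereal_scope.

Definition lebesgue_rV_step : set 'rV[R]_n.+1 -> \bar R :=
  pushforward (@lebesgue_measure R \x mu) (@cons_rV n).

Let step0 : lebesgue_rV_step set0 = 0.
Proof. by rewrite /lebesgue_rV_step /pushforward preimage_set0 measure0. Qed.

Let step_ge0 A : 0 <= lebesgue_rV_step A.
Proof. exact: measure_ge0. Qed.

Let step_sigma_additive : semi_sigma_additive lebesgue_rV_step.
Proof. exact: measure_semi_sigma_additive. Qed.

HB.instance Definition _ := isMeasure.Build _ _ _ lebesgue_rV_step
  step0 step_ge0 step_sigma_additive.

Let step_sigma_finite : sigma_finite setT lebesgue_rV_step.
Proof.
pose h (x : 'rV[R]_n.+1) : (measurableTypeR R * 'rV[R]_n)%type :=
  (coord_rV ord0 x, @rsubmx R 1 1 n x).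
have mh : measurable_fun setT h.
  apply/measurable_fun_pairP; split; first exact: measurable_coord_rV.
  apply: measurable_fun_rV => i.
  rewrite (_ : _ \o _ = coord_rV (rshift 1 i : 'I_n.+1)).
    exact: measurable_coord_rV.
  by apply/funext => x; rewrite /coord_rV /= mxE.
have hK p : h (cons_rV p) = p.
  rewrite /h /cons_rV row_mxKr; case: p => a v; congr pair.
  rewrite /coord_rV mxE; case: fintype.splitP => [j _|//].
  by rewrite !ord1 mxE eqxx mulr1n.
have /sigma_finiteP[F [TF ndF Foo]] := sigma_finiteT (@lebesgue_measure R).
have /sigma_finiteP[G [TG ndG Goo]] := sigma_finiteT mu.
exists (fun k => h @^-1` (F k `*` G k)).
  apply/esym/seteqP; split=> // x _.
  have [i _ Fi] : (\bigcup_i F i) (h x).1 by rewrite -TF.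
  have [j _ Gj] : (\bigcup_i G i) (h x).2 by rewrite -TG.
  exists (maxn i j) => //; split.
    by move: Fi; exact/subsetPset/ndF/leq_maxl.
  by move: Gj; exact/subsetPset/ndG/leq_maxr.
move=> k; have [mF Fkoo] := Foo k; have [mG Gkoo] := Goo k; split.
  by rewrite -[X in measurable X]setTI; apply: mh => //; exact: measurableX.
rewrite /lebesgue_rV_step /pushforward -comp_preimage.
rewrite (_ : h \o _ = id); last by apply/funext => p; exact: hK.
by rewrite preimage_id product_measure1E// lte_mul_pinfty// ge0_fin_numE.
Qed.

HB.instance Definition _ := Measure_isSigmaFinite.Build _ _ _ lebesgue_rV_step
  step_sigma_finite.

End step.

Fixpoint lebesgue_rV n : {sigma_finite_measure set 'rV[R]_n -> \bar R} :=
  match n with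
  | 0 => \d_(0 : 'rV[R]_0)
  | n'.+1 => lebesgue_rV_step (lebesgue_rV n')
  end.

End lebesgue_measure_rV.

Section box.
Context {R : realType} (n : nat).
Implicit Types a b x : 'rV[R]_n.

Definition box a b : set 'rV[R]_n :=
  [set x | forall i, a ord0 i <= x ord0 i <= b ord0 i].

Lemma measurable_box a b : measurable (box a b).
Proof.
rewrite (_ : box a b =
    \bigcap_(i in [set: 'I_n]) (coord_rV i @^-1` `[a ord0 i, b ord0 i])).
  apply: fin_bigcap_measurable => [|i _]; first exact: finite_finset.
  by rewrite -[X in measurable X]setTI; exact: measurable_coord_rV.
apply/seteqP; split=> x /= hx i; first by move=> _; rewrite /= in_itv/=; exact: hx.
by have := hx i I; rewrite /= in_itv.
Qed.

End box.

(* The recursive construction above gives boxes their usual volume. *)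
Lemma lebesgue_rV_box {R : realType} n (a b : 'rV[R]_n) :
  (forall i, a ord0 i <= b ord0 i) ->
  lebesgue_rV n (box a b) = (\prod_(i < n) (b ord0 i - a ord0 i))%:E.
Proof.
elim: n a b => [|n IHn] a b ab.
  by rewrite big_ord0 /= diracE mem_set// => -[].
pose a' := \row_i a ord0 (lift ord0 i); pose b' := \row_i b ord0 (lift ord0 i).
have ab' i : a' ord0 i <= b' ord0 i by rewrite !mxE.
have split_box : @cons_rV R n @^-1` box a b =
    `[a ord0 ord0, b ord0 ord0]%classic `*` box a' b'.
  have c0 (p : measurableTypeR R * 'rV[R]_n) : cons_rV p ord0 ord0 = p.1.
    rewrite mxE; case: fintype.splitP => [j _|//].
    by rewrite !ord1 mxE eqxx mulr1n.
  have cS (p : measurableTypeR R * 'rV[R]_n) i :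
      cons_rV p ord0 (lift ord0 i) = p.2 ord0 i.
    rewrite mxE; case: fintype.splitP => [j|k].
      by rewrite ord1.
    by move=> [] /val_inj ->.
  apply/seteqP; split=> p.
    move=> h; split=> /=; first by rewrite in_itv/= -(c0 p); exact: h.
    by move=> i; rewrite !mxE -cS; exact: h.
  move=> [/= + h] i; rewrite in_itv /= => h0.
  case: (unliftP ord0 i) => [j|] ->; last by rewrite c0.
  by rewrite cS; have := h j; rewrite !mxE.
rewrite /= /lebesgue_rV_step /pushforward split_box product_measure1E//; last first.
  exact: measurable_box.
rewrite IHn// big_ord_recl EFinM; congr (_ * _)%E.
  rewrite [LHS]lebesgue_measure_itv /= lte_fin.
  by have := ab ord0; rewrite le_eqVlt => /orP[/eqP ->|->//]; rewrite ltxx subrr.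
by congr EFin; apply: eq_bigr => i _; rewrite !mxE.
Qed.

Section norms.
Context {R : realType} (d : nat).
Implicit Types (D : set 'rV[R]_d) (omega : probability 'rV[R]_d R).

(* The library's norm on row vectors is the sup norm. *)
Definition enorm (x : 'rV[R]_d) : R := Num.sqrt (\sum_(i < d) x ord0 i ^+ 2).

Definition Linfty_norm D (mD : measurable D) (g : 'rV[R]_d -> R) : \bar R :=
  'N[mrestr (lebesgue_rV d) mD]_+oo[EFin \o g].

Definition Linfty_norm2 D (mD : measurable D) (h : 'rV[R]_d -> 'rV[R]_d) :=
  Linfty_norm mD (enorm \o h).

Definition L2inner omega D (g h : 'rV[R]_d -> R) : R :=
  \int[omega]_(x in D) (g x * h x).

Definition L2norm omega D g : R := Num.sqrt (L2inner omega D g g).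

Definition L2norm2 omega D (h : 'rV[R]_d -> 'rV[R]_d) : R :=
  Num.sqrt (\sum_(l < d) L2norm omega D (fun x => h x ord0 l) ^+ 2).

End norms.

Section polynomial_space.
Context {R : realType} (d : nat).
Implicit Types (p : mpoly.mpoly d R) (V : set (mpoly.mpoly d R)).
Implicit Types (D : set 'rV[R]_d) (omega : probability 'rV[R]_d R).

Definition evalp p (x : 'rV[R]_d) : R := mpoly.meval (fun i => x ord0 i) p.

Definition evalp_rV (p : 'I_d -> mpoly.mpoly d R) (x : 'rV[R]_d) : 'rV[R]_d :=
  \row_l evalp (p l) x.

Definition is_basis V N (b : 'I_N -> mpoly.mpoly d R) : Prop :=
  V = [set \sum_(i < N) c i *: b i | c in [set: 'I_N -> R]] /\
  forall c : 'I_N -> R, \sum_(i < N) c i *: b i = 0 -> forall i, c i = 0.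

(* Elements of V are formal polynomials.  When omega is absolutely continuous
   and carried by D, evaluation maps them injectively into L^2_omega(D), so N
   is also the dimension of V as a subspace of L^2_omega(D). *)
Definition has_dim V N : Prop := exists b : 'I_N -> mpoly.mpoly d R, is_basis V b.

Definition is_orthonormal_basis omega D V N (psi : 'I_N -> mpoly.mpoly d R) :=
  is_basis V psi /\
  forall i j, L2inner omega D (evalp (psi i)) (evalp (psi j)) = (i == j)%:R.

(* The choice of the orthonormal basis does not affect the value. *)
Definition kernel_diag omega D V N (x : 'rV[R]_d) : R :=
  let psi := xget (fun=> 0) [set psi : 'I_N -> mpoly.mpoly d R |
                               is_orthonormal_basis omega D V psi] in
  \sum_(j < N) evalp (psi j) x ^+ 2.

Definition L2proj omega D V (g : 'rV[R]_d -> R) : mpoly.mpoly d R :=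
  xget 0 [set p | V p /\ forall q, V q ->
            L2inner omega D (fun x => g x - evalp p x) (evalp q) = 0].

Definition L2proj_rV omega D V (f : 'rV[R]_d -> 'rV[R]_d) : 'rV[R]_d -> 'rV[R]_d :=
  evalp_rV (fun l => L2proj omega D V (fun x => f x ord0 l)).

End polynomial_space.

(* Two-sided derivative inside the interval, continuity up to its end points. *)
Definition ode_solution {R : realType} d (F : 'rV[R]_d -> 'rV[R]_d) (t0 T : R)
    (y : R -> 'rV[R]_d) : Prop :=
  {within `[t0, T], continuous y} /\
  forall t, t0 < t < T -> is_derive t 1 y (F (y t)).

(* Main.v *)
(* Pairing x - u with the vector x(t) - u(t) turns the norm estimate into a scalar
   comparison of derivatives, which gives the integral inequality; comparing
   (M (s - t0) + L int e + M / L) exp (- L (s - t0)) at t0 and t gives Gronwall's bound.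
   The essential suprema are true pointwise bounds on the box because the functions
   are continuous there and every point of the box has relative neighbourhoods of
   positive Lebesgue measure.  For q in V, expanding q in an orthonormal basis and
   Cauchy-Schwarz give q(y)^2 <= ||q||^2 K(y), to be applied to ftilde - P_V f.
   The orthonormal basis comes from Gram-Schmidt: the L^2_omega product is definite
   on polynomials since the zero set of a nonzero polynomial is Lebesgue-null
   (induction on the number of variables and Fubini). *)
Require Import Defs.
From HB Require Import structures.
From mathcomp Require Import all_boot all_order all_algebra.
From mathcomp Require Import all_classical all_reals all_analysis.
From mathcomp Require Import (canonicals) mpoly.
From mathcomp Require Import measurable_realfun ess_sup_inf ring lra.

Set Implicit Arguments.
Unset Strict Implicit.
Unset Printing Implicit Defensive.

Import Order.TTheory GRing.Theory Num.Theory.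
Import numFieldNormedType.Exports.
Local Open Scope classical_set_scope.
Local Open Scope ring_scope.

(** * The Euclidean norm *)

(** Cauchy-Schwarz without square roots or division: the sum of the squares
    [(B * a i - P * b i) ^+ 2] equals [B * (A * B - P ^+ 2)], and [B] can be cancelled when
    positive. If [B = 0], all [b i] vanish. *)
Lemma sum_mul_sqr_le (R : realDomainType) (I : finType) (a b : I -> R) :
  (\sum_i a i * b i) ^+ 2 <= (\sum_i a i ^+ 2) * (\sum_i b i ^+ 2).
Proof.
set P := \sum_i a i * b i; set A := \sum_i a i ^+ 2; set B := \sum_i b i ^+ 2.
have B0 : 0 <= B by apply: sumr_ge0 => i _; exact: sqr_ge0.
have [B_eq0|Bneq0] := eqVneq B 0.
  have b0 i : b i = 0.
    have sqb0 (j : I) : true -> 0 <= b j ^+ 2 by rewrite sqr_ge0.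
    have /eqP : b i ^+ 2 = 0 by apply: (psumr_eq0P sqb0 B_eq0).
    by rewrite sqrf_eq0 => /eqP.
  by rewrite B_eq0 mulr0 /P big1 ?expr0n// => i _; rewrite b0 mulr0.
have : 0 <= \sum_i (B * a i - P * b i) ^+ 2.
  by apply: sumr_ge0 => i _; exact: sqr_ge0.
have -> : \sum_i (B * a i - P * b i) ^+ 2 = B * (A * B - P ^+ 2).
  have sqE (c k : R) :
      \sum_i (c * a i - k * b i) ^+ 2 = c ^+ 2 * A - 2 * c * k * P + k ^+ 2 * B.
    rewrite /A /B /P !mulr_sumr -!sumrB -big_split /=.
    by apply: eq_bigr => i _; ring.
  by rewrite sqE; ring.
by rewrite pmulr_rge0 ?subr_ge0// lt_def Bneq0.
Qed.

Lemma sum_continuous (R : realType) (T : topologicalType) (I : Type)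
    (r : seq I) (g : I -> T -> R) :
  (forall i, continuous (g i)) -> continuous (fun z => \sum_(i <- r) g i z).
Proof. by move=> gc; apply: continuous_big => //; exact: add_continuous. Qed.

Lemma prod_continuous (R : realType) (T : topologicalType) (I : Type)
    (r : seq I) (g : I -> T -> R) :
  (forall i, continuous (g i)) -> continuous (fun z => \prod_(i <- r) g i z).
Proof. by move=> gc; apply: continuous_big => //; exact: mul_continuous. Qed.

Section enorm.
Context {R : realType} (d : nat).
Implicit Types v w : 'rV[R]_d.

Lemma enorm_ge0 v : 0 <= enorm v.
Proof. exact: sqrtr_ge0. Qed.

Lemma enorm_sqr v : enorm v ^+ 2 = \sum_(i < d) v ord0 i ^+ 2.
Proof. by rewrite sqr_sqrtr// sumr_ge0// => i _; exact: sqr_ge0. Qed.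

Lemma dot_le_enorm v w : \sum_(i < d) v ord0 i * w ord0 i <= enorm v * enorm w.
Proof.
rewrite (le_trans (ler_norm _))// -sqrtr_sqr -sqrtrM; last first.
  by rewrite sumr_ge0// => i _; exact: sqr_ge0.
by rewrite ler_wsqrtr// sum_mul_sqr_le.
Qed.

Lemma enormD v w : enorm (v + w) <= enorm v + enorm w.
Proof.
rewrite -(ler_pXn2r (n := 2))// ?nnegrE ?addr_ge0 ?enorm_ge0//.
rewrite sqrrD !enorm_sqr; have := dot_le_enorm v w.
have -> : \sum_(i < d) (v + w) ord0 i ^+ 2 = \sum_(i < d) v ord0 i ^+ 2
    + \sum_(i < d) w ord0 i ^+ 2 + (\sum_(i < d) v ord0 i * w ord0 i) *+ 2.
  rewrite -sumrMnl -!big_split /=.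
  by apply: eq_bigr => i _; rewrite mxE; ring.
by lra.
Qed.

Lemma enormN v : enorm (- v) = enorm v.
Proof.
by rewrite /enorm; congr Num.sqrt; apply: eq_bigr => i _; rewrite mxE sqrrN.
Qed.

Lemma enorm0 : enorm (0 : 'rV[R]_d) = 0.
Proof.
by rewrite /enorm big1 ?sqrtr0// => i _; rewrite mxE expr0n.
Qed.

Lemma enorm_comp_continuous (T : topologicalType) (F : T -> 'rV[R]_d) :
  (forall i, continuous (fun z => F z ord0 i)) -> continuous (fun z => enorm (F z)).
Proof.
move=> Fc z; apply: (@continuous_comp _ _ _
  (fun z => \sum_(i < d) F z ord0 i ^+ 2) Num.sqrt); last first.
  exact: sqrt_continuous.
move: z; apply: sum_continuous => i z.
apply: (@continuous_comp _ _ _ (fun z => F z ord0 i)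
  (fun r : R => r ^+ 2)); [exact: Fc|exact: exprn_continuous].
Qed.

Lemma enorm_continuous : continuous (@enorm R d).
Proof. by apply: (@enorm_comp_continuous _ id) => i; exact: coord_continuous. Qed.

Lemma dot_continuous w : continuous (fun v : 'rV[R]_d =>
  \sum_(i < d) w ord0 i * v ord0 i).
Proof.
apply: sum_continuous => i v.
by apply: continuousM; [exact: cst_continuous|exact: coord_continuous].
Qed.

End enorm.

(** * Comparison of solutions of differential equations *)

Section ode.
Context {R : realType}.

Lemma is_derive_ge0_le (h dh : R -> R) (a b : R) : a <= b ->
  {within `[a, b], continuous h} ->
  (forall s, a < s < b -> is_derive s 1 h (dh s)) ->
  (forall s, a < s < b -> 0 <= dh s) -> h a <= h b.
Proof.
move=> ab ch hd dh0; apply: (@ger0_derive1_ndecr _ h a b) => //.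
- by move=> s; rewrite in_itv/= => /hd[].
- by move=> s; rewrite in_itv/= => sab; have hs := hd _ sab;
  rewrite derive1E derive_val dh0.
Qed.

Lemma is_derive_coord n (y : R -> 'rV[R]_n) (t : R) (v : 'rV[R]_n) i :
  is_derive t 1 y v -> is_derive t 1 (fun s => y s ord0 i) (v ord0 i).
Proof.
move=> [dy <-]; rewrite derive_mx// mxE; apply: DeriveDef => //.
exact: (derivable_mxP _ _ _).1.
Qed.

Context (d : nat) (D : set 'rV[R]_d) (F G : 'rV[R]_d -> 'rV[R]_d) (M L : R).
Context (t0 T : R) (u x : R -> 'rV[R]_d).
Context (L0 : 0 < L).
Context (LipF : forall y z, D y -> D z -> enorm (F y - F z) <= L * enorm (y - z)).
Context (FG : forall y, D y -> enorm (G y - F y) <= M).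
Context (hu : ode_solution F t0 T u).
Context (hx : ode_solution G t0 T x).
Context (hxu0 : x t0 = u t0).
Context (uD : forall t, t0 <= t <= T -> D (u t)).
Context (xD : forall t, t0 <= t <= T -> D (x t)).

Let e s := enorm (x s - u s).
Let mu := @lebesgue_measure R.

Let xu_cont : {within `[t0, T], continuous (x - u)}.
Proof. by apply: within_continuousB; [exact: hx.1|exact: hu.1]. Qed.

Let e_cont : {within `[t0, T], continuous e}.
Proof.
by apply: (@within_continuous_comp _ _ _ _ (x - u) (@enorm R d)) => // v _;
  exact: enorm_continuous.
Qed.

Let M0 t : t0 <= t <= T -> 0 <= M.
Proof. by move=> /uD /FG; exact/le_trans/enorm_ge0. Qed.

Let int_e t := parameterized_integral mu t0 t e.

Section fixed_time.
Context (t : R).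
Context (tt : t0 < t) (tT : t <= T).

Let sub : `[t0, t] `<=` `[t0, T].
Proof. by apply: subset_itvl; rewrite bnd_simp. Qed.

Let intble : mu.-integrable `[t0, t] (EFin \o e).
Proof.
apply: continuous_compact_integrable; first exact: segment_compact.
exact: continuous_subspaceW e_cont.
Qed.

Lemma int_e_cont : {within `[t0, t], continuous int_e}.
Proof. by apply: parameterized_integral_continuous => //; exact: ltW. Qed.

Lemma int_e_derive s : t0 < s < t -> is_derive s 1 int_e (e s).
Proof.
move=> /andP[ts st].
have es : {for s, continuous e}.
  apply: (@within_continuous_continuous _ _ _ t0 t) => //.
    exact: continuous_subspaceW e_cont.
  by rewrite in_itv/= ts.
have [di <-] := continuous_FTC1_closed st intble ts es.
by rewrite derive1E; apply: DeriveDef.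
Qed.

(** The norm is not differentiable at 0, so [e] is not differentiated. The vector [w] is frozen at
    time [t], which makes [phi] differentiable in [s]; Cauchy-Schwarz bounds its derivative by
    [e t * (M + L * e s)]. Since [phi t0 = 0] and [phi t = e t ^+ 2], monotonicity of [h] gives the
    claim multiplied by [e t]. *)
Lemma ode_integral_ineq_gt : e t <= M * (t - t0) + L * int_e t.
Proof.
pose w := x t - u t.
pose phi s := \sum_(i < d) w ord0 i * (x s - u s) ord0 i.
pose dphi s := \sum_(i < d) w ord0 i * (G (x s) - F (u s)) ord0 i.
pose h s := e t * (M * (s - t0) + L * int_e s) - phi s.
pose dh s := e t * (M + L * e s) - dphi s.
have et0 : 0 <= e t by exact: enorm_ge0.
have int0 : int_e t0 = 0.
  by rewrite /int_e /parameterized_integral set_itv1 Rintegral_set1.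
have phit0 : phi t0 = 0.
  by rewrite /phi hxu0 subrr big1// => i _; rewrite [X in _ * X]mxE mulr0.
have phit : phi t = e t ^+ 2.
  by rewrite /e enorm_sqr; apply: eq_bigr => i _; rewrite -expr2.
have : h t0 <= h t.
  apply: (@is_derive_ge0_le h dh); first exact: ltW.
  - apply: (@within_continuousB _ _ _ _
      (fun s => e t * (M * (s - t0) + L * int_e s)) phi).
      move=> s; apply: cvgM; first exact: cvg_cst.
      apply: cvgD; apply: cvgM; try exact: cvg_cst.
        by apply: cvgB; [exact: (continuous_subspaceT (fun=> @cvg_id R _))|exact: cvg_cst].
      exact: int_e_cont.
    apply: (@within_continuous_comp _ _ _ _ (x - u)
      (fun v => \sum_(i < d) w ord0 i * v ord0 i)) => [v _|].
      exact: dot_continuous.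
    exact: continuous_subspaceW xu_cont.
  - move=> s /andP[ts st].
    have hi : is_derive s 1 int_e (e s) by apply: int_e_derive; rewrite ts.
    have sT : t0 < s < T by rewrite ts (lt_le_trans st).
    have hphi : is_derive s 1 phi (dphi s).
      rewrite (_ : phi = \sum_(i < d)
          (w ord0 i \*: (fun s => (x s - u s) ord0 i))); last first.
        by apply/funext => z; rewrite fct_sumE.
      apply: is_derive_sum => i; apply: is_deriveZ; apply: is_derive_coord.
      by apply: is_deriveB; [exact: hx.2|exact: hu.2].
    rewrite (_ : h = e t \*: (M \*: (id - cst t0) + L \*: int_e) - phi)//.
    by apply: is_derive_eq; rewrite /dh /GRing.scale/= subr0 mulr1.
  - move=> s /andP[ts st].
    have tsT : t0 <= s <= T by rewrite !ltW// (lt_le_trans st).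
    rewrite subr_ge0 (le_trans (dot_le_enorm _ _))// ler_wpM2l//.
    (* The intermediate term [F (x s)] separates the defect of [G], bounded by [M], from the
       Lipschitz increment of [F], bounded by [L * e s]. *)
    rewrite (_ : _ - _ = (G (x s) - F (x s)) + (F (x s) - F (u s))); last first.
      by rewrite addrA subrK.
    rewrite (le_trans (enormD _ _))// lerD//; first by apply/FG/xD.
    by apply: LipF; [exact: xD|exact: uD].
rewrite /h int0 phit0 phit subrr !(mulr0, addr0, subr0) subr_ge0 expr2.
(* Cancelling the factor [e t] requires it to be nonzero; when it is zero, the right-hand side only
   has to be nonnegative. *)
have [et_eq0 _|et_neq0] := eqVneq (e t) 0; last first.
  by rewrite ler_pM2l// lt_def et_neq0.
rewrite et_eq0 addr_ge0// mulr_ge0 ?(ltW L0) ?subr_ge0 ?(ltW tt)//.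
  by apply: (@M0 t); rewrite (ltW tt).
by apply: Rintegral_ge0 => s _; exact: enorm_ge0.
Qed.
End fixed_time.

Lemma ode_integral_ineq t : t0 <= t <= T ->
  e t <= M * (t - t0) + L * \int[mu]_(s in `[t0, t]) e s.
Proof.
move=> /andP[]; rewrite le_eqVlt => /predU1P[<- _|tt tT];
  last exact: ode_integral_ineq_gt.
by rewrite /e hxu0 !subrr enorm0 set_itv1 Rintegral_set1 !mulr0 addr0.
Qed.

(** The summand [M / L] in [psi] absorbs the constant [M] of its derivative: [L * psi s] minus
    [M + L * e s] is [L] times the slack of the integral inequality at [s]. Hence [psi * E] is
    nonincreasing and [psi t] is at most [M / L * expR (L * (t - t0))]; the integral inequality at
    [t] bounds [e t] by [psi t - M / L]. *)
Lemma ode_gronwall_gt t : t0 < t -> t <= T -> e t <= M / L * (expR (L * (t - t0)) - 1).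
Proof.
pose E s := expR (- L * (s - t0)).
pose psi s := M * (s - t0) + L * int_e s + M / L.
pose h s := - (psi s * E s).
pose dh s := L * E s * (M * (s - t0) + L * int_e s - e s).
move=> tt tT; have Lneq0 : L != 0 by rewrite gt_eqF.
have int0 : int_e t0 = 0.
  by rewrite /int_e /parameterized_integral set_itv1 Rintegral_set1.
have E_cont : continuous E.
  move=> s; apply: (@continuous_comp _ _ _ (fun s => - L * (s - t0)) expR).
    apply: continuousM; first exact: cst_continuous.
    by apply: continuousB; [exact: cvg_id|exact: cst_continuous].
  exact: continuous_expR.
have : h t0 <= h t.
  apply: (@is_derive_ge0_le h dh); first exact: ltW.
  - move=> s; apply: cvgN; apply: cvgM; last exact: (continuous_subspaceT E_cont).
    apply: cvgD; last exact: cvg_cst.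
    apply: cvgD; apply: cvgM; try exact: cvg_cst.
      by apply: cvgB; [exact: (continuous_subspaceT (fun=> @cvg_id R _))|exact: cvg_cst].
    exact: (int_e_cont tt tT).
  - move=> s tst.
    have hi := int_e_derive tt tT tst.
    have hE : is_derive s 1 E (- L * E s).
      rewrite (_ : E = expR \o (- L \*: (id - cst t0)))//.
      apply: is_derive_eq.
      by rewrite /GRing.scale/= subr0 mulr1 mulrC.
    rewrite (_ : h = - ((M \*: (id - cst t0) + L \*: int_e + cst (M / L)) * E))//.
    apply: is_derive_eq.
    rewrite /dh /psi /GRing.scale/= !fctE /GRing.scale/= subr0 mulr1 addr0.
    transitivity (- ((M * (s - t0) + L * int_e s + M / L) * (- L * E s)
      + E s * (M + L * e s))) => //.
    by field.
  - move=> s /andP[ts st].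
    rewrite mulr_ge0 ?mulr_ge0 ?expR_ge0 ?(ltW L0)// subr_ge0.
    by apply: ode_integral_ineq; rewrite !ltW// (lt_le_trans st).
rewrite /h /psi int0 /E subrr !(mulr0, addr0, add0r, expR0, mulr1) lerN2.
rewrite mulNr expRN ler_pdivrMr ?expR_gt0// => ineq.
rewrite (le_trans (ode_integral_ineq_gt tt tT))// [leRHS]mulrBr mulr1 lerBrDr.
exact: ineq.
Qed.

Lemma ode_gronwall t : t0 <= t <= T -> e t <= M / L * (expR (L * (t - t0)) - 1).
Proof.
move=> /andP[]; rewrite le_eqVlt => /predU1P[<- _|tt tT];
  last exact: ode_gronwall_gt.
by rewrite /e hxu0 !subrr enorm0 mulr0 expR0 subrr mulr0.
Qed.

End ode.

(** * Zero sets of polynomials *)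

Section polynomial_functions.
Context {R : realType} (d : nat).
Implicit Types (p q : mpoly.mpoly d R) (v : 'rV[R]_d).

Lemma evalpE p v : evalp p v = \sum_(m <- mpoly.msupp p)
  (mpoly.mcoeff m p * \prod_i v ord0 i ^+ mpoly.fun_of_multinom m i).
Proof. exact: mpoly.mevalE. Qed.

Lemma evalpM p q v : evalp (p * q) v = evalp p v * evalp q v.
Proof. exact: mpoly.mevalM. Qed.

Lemma evalpB p q v : evalp (p - q) v = evalp p v - evalp q v.
Proof. exact: mpoly.mevalB. Qed.

Lemma evalp_lincomb (I : Type) (r : seq I) (c : I -> R)
    (b : I -> mpoly.mpoly d R) v :
  evalp (\sum_(i <- r) c i *: b i) v = \sum_(i <- r) c i * evalp (b i) v.
Proof.
by rewrite /evalp raddf_sum; apply: eq_bigr => i _; rewrite /= mpoly.mevalZ.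
Qed.

Lemma evalp_continuous p : continuous (evalp p).
Proof.
rewrite (_ : evalp p = fun v => \sum_(m <- mpoly.msupp p) (mpoly.mcoeff m p *
    \prod_(i < d) v ord0 i ^+ (mpoly.fun_of_multinom m i))); last first.
  by apply/funext => v; rewrite evalpE.
apply: sum_continuous => m v.
apply: continuousM; first exact: cst_continuous.
move: v; apply: prod_continuous => i v.
apply: (@continuous_comp _ _ _ (fun v : 'rV[R]_d => v ord0 i)
  (fun r : R => r ^+ _)); [exact: coord_continuous|exact: exprn_continuous].
Qed.

Lemma measurable_evalp p : measurable_fun [set: 'rV[R]_d] (evalp p).
Proof.
rewrite (_ : evalp p = fun v => \sum_(m <- mpoly.msupp p) (mpoly.mcoeff m p *
    \prod_(i < d) v ord0 i ^+ (mpoly.fun_of_multinom m i))); last first.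
  by apply/funext => v; rewrite evalpE.
apply: measurable_sum => m; apply: measurable_funM; first exact: measurable_cst.
apply: measurable_prod => i _; apply: measurable_funX.
exact: measurable_coord_rV.
Qed.

(** On the box each coordinate is at most [|a_i| + |b_i|] in absolute value, so every monomial is
    bounded. This makes polynomials integrable for [omega]. *)
Lemma evalp_bounded p (a b : 'rV[R]_d) :
  exists C, forall v, box a b v -> `|evalp p v| <= C.
Proof.
exists (\sum_(m <- mpoly.msupp p) `|mpoly.mcoeff m p| * \prod_(i < d)
  (`|a ord0 i| + `|b ord0 i|) ^+ (mpoly.fun_of_multinom m i)) => v abv.
rewrite evalpE (le_trans (ler_norm_sum _ _ _))//; apply: ler_sum => m _.
rewrite normrM ler_wpM2l// normr_prod; apply: ler_prod => i _.
rewrite normr_ge0 normrX lerXn2r ?nnegrE ?addr_ge0//=.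
have /andP[av vb] := abv i; rewrite ler_norml; apply/andP; split.
  have := normr_ge0 (b ord0 i); have := ler_norm (- a ord0 i); rewrite normrN; lra.
have := normr_ge0 (a ord0 i); have := ler_norm (b ord0 i); lra.
Qed.

End polynomial_functions.

Section zero_set.
Context {R : realType}.

Lemma zeros_poly_finite (p : {poly R}) : p != 0 ->
  finite_set [set a | p.[a] = 0].
Proof.
have [n] := ubnP (size p); elim: n p => // n IHn p sp p0.
have [[a /eqP pa]|nroot] := pselect (exists a, p.[a] = 0); last first.
  rewrite (_ : [set _ | _] = set0)// -subset0 => a /= pa.
  by apply: nroot; exists a.
have /factor_theorem[q pE] : root p a by exact: pa.
have q0 : q != 0 by apply: contraNneq p0 => q0; rewrite pE q0 mul0r.
have /(IHn q) qc : (size q < n)%N.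
  by move: sp; rewrite pE size_Mmonic ?monicXsubC// size_XsubC addn2.
apply: (@sub_finite_set _ _ ([set a] `|` [set a | q.[a] = 0])); last first.
  by rewrite finite_setU; split; [exact: finite_set1|exact: qc].
move=> b /=; rewrite pE hornerM hornerXsubC => /eqP.
rewrite mulf_eq0 => /orP[/eqP|]; first by right.
by rewrite subr_eq0 => /eqP; left.
Qed.

Definition mnm_tail n (m : mpoly.multinom n.+1) : mpoly.multinom n :=
  mpoly.Multinom [tuple mpoly.fun_of_multinom m (lift ord0 i) | i < n].

(* The coefficient of the k-th power of the first variable, as a polynomial in
   the other ones. *)
Definition coeff_head n (p : mpoly.mpoly n.+1 R) k : mpoly.mpoly n R :=
  \sum_(m <- mpoly.msupp p | mpoly.fun_of_multinom m ord0 == k)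
     mpoly.mcoeff m p *: mpoly.mpolyX R (mnm_tail m).

(** Take a monomial [m0] of the support and let [k] be its exponent in the first variable. A
    monomial is determined by its first exponent and its tail, so no other term contributes to the
    coefficient of [mnm_tail m0], which is that of [m0] in [p]. *)
Lemma coeff_head_neq0 n (p : mpoly.mpoly n.+1 R) : p != 0 ->
  exists k, coeff_head p k != 0.
Proof.
move=> p0; have /hasP[m0 m0p _] : has predT (mpoly.msupp p).
  by rewrite has_predT lt0n size_eq0 mpoly.msupp_eq0.
exists (mpoly.fun_of_multinom m0 ord0); apply/eqP.
move=> /(congr1 (mpoly.mcoeff (mnm_tail m0))) /eqP; apply/negP.
rewrite raddf_sum /= raddf0 big_mkcond (bigD1_seq m0) ?mpoly.msupp_uniq//= eqxx.
rewrite mpoly.mcoeffZ mpoly.mcoeffX eqxx mulr1 big1 ?addr0 -?mpoly.mcoeff_msupp//.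
move=> m mm0; case: ifPn => // /eqP m0E; rewrite mpoly.mcoeffZ mpoly.mcoeffX.
case: eqVneq => [tE|_]; last by rewrite mulr0.
case/eqP: mm0; apply/mpoly.mnmP => i; case: (unliftP ord0 i) => [j|] ->//.
have /mpoly.mnmP/(_ j) := tE.
by rewrite !mpoly.mnmE.
Qed.

(** Freezing all variables but the first leaves a univariate polynomial; this describes the slices
    used in the Fubini argument of [zeros_null]. *)
Lemma evalp_cons_rV n (p : mpoly.mpoly n.+1 R) (v : 'rV[R]_n) :
  exists q : {poly R}, (forall k, q`_k = evalp (coeff_head p k) v) /\
    forall a, evalp p (cons_rV (a, v)) = q.[a].
Proof.
pose c (m : mpoly.multinom n.+1) := mpoly.mcoeff m p *
  \prod_(i < n) v ord0 i ^+ mpoly.fun_of_multinom m (lift ord0 i).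
exists (\sum_(m <- mpoly.msupp p) c m *: 'X^(mpoly.fun_of_multinom m ord0)).
split=> [k|a].
  rewrite coef_sum /coeff_head /evalp raddf_sum [RHS]big_mkcond/=.
  apply: eq_bigr => m _; rewrite coefZ coefXn eq_sym.
  case: eqP => _; rewrite ?(mulr0, mulr1)// mpoly.mevalZ mpoly.mevalX.
  by congr (_ * _); apply: eq_bigr => i _; rewrite mpoly.mnmE.
rewrite evalpE horner_sum; apply: eq_bigr => m _.
rewrite hornerZ hornerXn big_ord_recl -mulrA; congr (_ * _).
rewrite mulrC; congr (_ * _); last first.
  congr (_ ^+ _); rewrite mxE; case: fintype.splitP => [j _|//].
  by rewrite !ord1 mxE eqxx mulr1n.
apply: eq_bigr => i _; congr (_ ^+ _); rewrite mxE.
by case: fintype.splitP => [j|k [] /val_inj ->//]; rewrite ord1.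
Qed.

Lemma measurable_zeros n (p : mpoly.mpoly n R) :
  measurable [set v : 'rV[R]_n | evalp p v = 0].
Proof.
rewrite -[X in measurable X]setTI.
exact: (measurable_evalp p measurableT (measurable_set1 0)).
Qed.

(** In dimension 0 a nonzero polynomial is a nonzero constant and the measure is a Dirac mass. In
    the induction step some [coeff_head p k] is nonzero, so its zero set is null; for [v] outside it
    the slice of the zero set of [p] is the root set of a nonzero univariate polynomial, hence
    finite. *)
Lemma zeros_null n (p : mpoly.mpoly n R) : p != 0 ->
  lebesgue_rV n [set v : 'rV[R]_n | evalp p v = 0] = 0%E.
Proof.
elim: n p => [|n IHn] p p0.
  rewrite /= diracE memNset// => /= /eqP; apply/negP.
  have /hasP[m0 m0p _] : has predT (mpoly.msupp p).
    by rewrite has_predT lt0n size_eq0 mpoly.msupp_eq0.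
  rewrite evalpE (bigD1_seq m0) ?mpoly.msupp_uniq//= big_ord0 mulr1.
  rewrite big1 ?addr0 -?mpoly.mcoeff_msupp// => m /eqP[].
  by apply/mpoly.mnmP => -[].
have [k pk0] := coeff_head_neq0 p0.
set Z := [set v | _].
have mZ : measurable (@cons_rV R n @^-1` Z).
  by rewrite -[X in measurable X]setTI; apply: measurable_cons_rV => //;
  exact: measurable_zeros.
rewrite /= /lebesgue_rV_step /pushforward.
(* The product measure is replaced by the one with the order of integration exchanged, so that the
   inner measure is that of a slice in the first variable. *)
rewrite (@product_measure_unique _ _ _ _ _ _ _
  (lebesgue_measure \x^ lebesgue_rV n)%E)//; last first.
  by move=> A B mA mB; rewrite /= product_measure2E.
change (\int[lebesgue_rV n]_v
  (lebesgue_measure \o ysection (@cons_rV R n @^-1` Z)) v = 0)%E.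
rewrite (ge0_ae_eq_integral (g := cst 0%E))//.
- by rewrite integral_cst// mul0e.
- exact: measurable_fun_ysection.
- exists [set v | evalp (coeff_head p k) v = 0]; split.
  + exact: measurable_zeros.
  + exact: IHn.
  + move=> v /= /not_implyP[_]; apply: contra_notP => pkv.
    have [q [qE pq]] := evalp_cons_rV p v.
    apply/countable_lebesgue_measure0/finite_set_countable.
    apply: (@sub_finite_set _ _ [set a | q.[a] = 0]); last first.
      apply: zeros_poly_finite; apply: contra_notN pkv => /eqP q0.
      by rewrite -qE q0 coef0.
    by move=> a; rewrite /ysection/= inE /Z /= pq.
Qed.

End zero_set.

(** * Orthonormal bases and the kernel bound *)

Section gram_schmidt.
Context {R : rcfType} {E : lmodType R} (ip : E -> E -> R).
Context (ipD : forall p q r, ip (p + q) r = ip p r + ip q r).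
Context (ipZ : forall a p q, ip (a *: p) q = a * ip p q).
Context (ipC : forall p q, ip p q = ip q p).
Context (ip_gt0 : forall p, p != 0 -> 0 < ip p p).

Lemma ip_lincomb N (c : 'I_N -> R) (b : 'I_N -> E) q :
  ip (\sum_(i < N) c i *: b i) q = \sum_(i < N) c i * ip (b i) q.
Proof.
elim/big_ind2 : _ => [|p x r y <- <-|i _]; last exact: ipZ.
  by have := ipZ 0 0 q; rewrite scale0r mul0r.
exact: ipD.
Qed.

Lemma ip_lincomb_orthonormal N (psi : 'I_N -> E) (c : 'I_N -> R) j :
  (forall i k, ip (psi i) (psi k) = (i == k)%:R) ->
  ip (\sum_(i < N) c i *: psi i) (psi j) = c j.
Proof.
move=> on; rewrite ip_lincomb (bigD1 j)//= on eqxx mulr1 big1 ?addr0// => i ij.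
by rewrite on (negbTE ij) mulr0.
Qed.

(** Induction on [N]: the tail [b'] is orthonormalised first, then [b ord0] minus its projection [s]
    onto the span of the tail is normalised and put in front. *)
Lemma gram_schmidt N (b : 'I_N -> E) :
  (forall c : 'I_N -> R, \sum_(i < N) c i *: b i = 0 -> forall i, c i = 0) ->
  exists2 psi : 'I_N -> E, (forall i k, ip (psi i) (psi k) = (i == k)%:R) &
    [set \sum_(i < N) c i *: b i | c in [set: 'I_N -> R]] =
    [set \sum_(i < N) c i *: psi i | c in [set: 'I_N -> R]].
Proof.
elim: N b => [|N IHN] b fb; first by exists b => // -[].
pose b' i := b (lift ord0 i).
pose cons_fun (T : Type) (z : T) (c : 'I_N -> T) i :=
  if unlift ord0 i is Some j then c j else z.
have cons0 T z c : @cons_fun T z c ord0 = z by rewrite /cons_fun unlift_none.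
have consS T z c i : @cons_fun T z c (lift ord0 i) = c i.
  by rewrite /cons_fun liftK.
have sum_cons (c : 'I_N.+1 -> R) (z : E) (g : 'I_N -> E) :
    \sum_(i < N.+1) c i *: cons_fun _ z g i
    = c ord0 *: z + \sum_(i < N) c (lift ord0 i) *: g i.
  rewrite big_ord_recl cons0; congr (_ + _).
  by apply: eq_bigr => i _; rewrite consS.
have sum_cons2 (r : R) (c : 'I_N -> R) (g : 'I_N.+1 -> E) :
    \sum_(i < N.+1) cons_fun _ r c i *: g i
    = r *: g ord0 + \sum_(i < N) c i *: g (lift ord0 i).
  rewrite big_ord_recl cons0; congr (_ + _).
  by apply: eq_bigr => i _; rewrite consS.
have [|psi' on' span'] := IHN b'.
  move=> c cb i; have := fb (cons_fun _ 0 c) _ (lift ord0 i).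
  rewrite consS; apply; rewrite big_ord_recl cons0 scale0r add0r -[RHS]cb.
  by apply: eq_bigr => j _; rewrite consS.
pose s := \sum_(i < N) ip (b ord0) (psi' i) *: psi' i.
have [d ds] : exists d : 'I_N -> R, \sum_(i < N) d i *: b' i = s.
  have : [set \sum_(i < N) c i *: psi' i | c in [set: 'I_N -> R]] s.
    by exists (fun i => ip (b ord0) (psi' i)).
  by rewrite -span' => -[d _ dE]; exists d.
pose v := b ord0 - s.
(* If [v] were zero, then, [s] being a combination of the tail, there would be a linear relation
   among the [b i] with coefficient 1 at [b ord0]. *)
have v0 : v != 0.
  apply/eqP => v0.
  suff /eqP : (1 : R) = 0 by rewrite oner_eq0.
  rewrite -(cons0 _ 1 (fun i => - d i)); apply: fb.
  rewrite big_ord_recl cons0 scale1r -[RHS]v0 /v -ds -sumrN; congr (_ + _).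
  by apply: eq_bigr => i _; rewrite consS scaleNr.
have vpsi i : ip v (psi' i) = 0.
  rewrite /v ipD -scaleN1r ipZ /s (@ip_lincomb_orthonormal N psi' _ i on').
  by rewrite mulN1r subrr.
pose k := (Num.sqrt (ip v v))^-1.
have k0 : k != 0 by rewrite invr_neq0// gt_eqF// sqrtr_gt0 ip_gt0.
exists (cons_fun _ (k *: v) psi').
  move=> i j; case: (unliftP ord0 i) => [i'|] ->; case: (unliftP ord0 j) => [j'|] ->;
    rewrite ?consS ?cons0.
  - by rewrite on' (inj_eq lift_inj).
  - by rewrite ipC ipZ vpsi mulr0.
  - by rewrite ipZ vpsi mulr0.
  - rewrite ipZ ipC ipZ eqxx mulrA -expr2 exprVn sqr_sqrtr ?mulVf// ?ltW ?ip_gt0//.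
    by rewrite gt_eqF ?ip_gt0.
have combB (z y : 'I_N -> R) (a : R) (g : 'I_N -> E) :
    \sum_(i < N) z i *: g i + a *: \sum_(i < N) y i *: g i
    = \sum_(i < N) (z i + a * y i) *: g i.
  by rewrite scaler_sumr -big_split/=; apply: eq_bigr => i _; rewrite scalerDl scalerA.
apply/seteqP; split=> _ [c _ <-] /=.
  have [c' _ c'E] : [set \sum_(i < N) c i *: psi' i | c in [set: 'I_N -> R]]
      (\sum_(i < N) c (lift ord0 i) *: b' i).
    by rewrite -span'; exists (fun i => c (lift ord0 i)).
  (* Substituting [b ord0 = v + s] puts the coefficient [c ord0 / k] on [k *: v] and adds [c ord0]
     times the coordinates of [s] to those of the tail. *)
  exists (cons_fun _ (c ord0 / k) (fun i => c' i + c ord0 * ip (b ord0) (psi' i))) => //.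
  rewrite sum_cons2 cons0 (eq_bigr (fun i => (c' i + c ord0 * ip (b ord0) (psi' i))
    *: psi' i)) => [|i _]; last by rewrite consS.
  rewrite -combB c'E -/s scalerA divfK// big_ord_recl /v scalerBr.
  by rewrite addrACA addNr addr0.
have [c' _ c'E] : [set \sum_(i < N) c i *: b' i | c in [set: 'I_N -> R]]
    (\sum_(i < N) c (lift ord0 i) *: psi' i).
  by rewrite span'; exists (fun i => c (lift ord0 i)).
(* Conversely [v = b ord0 - s], where [s] is expanded in the tail with the coefficients [d]. *)
exists (cons_fun _ (c ord0 * k) (fun i => c' i + - (c ord0 * k) * d i)) => //.
rewrite sum_cons2 sum_cons -combB c'E ds scalerA /v scalerBr scaleNr -!addrA.
by congr (_ + _); rewrite addrC.
Qed.

End gram_schmidt.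

Section kernel.
Context {R : realType} (d : nat) (a b : 'rV[R]_d) (omega : probability 'rV[R]_d R).
Context (omegaD : omega (box a b) = 1%E) (omega_ac : omega `<< lebesgue_rV d).
Implicit Types p q : mpoly.mpoly d R.

Let D := box a b.
Let mD : measurable D := measurable_box a b.
Let ip p q := L2inner omega D (evalp p) (evalp q).

Lemma integrable_evalp p : omega.-integrable D (EFin \o evalp p).
Proof.
apply: measurable_bounded_integrable => //.
- by rewrite [X in (X < _)%E](_ : _ = 1%E)// ltry.
- exact: (measurable_funS _ _ (measurable_evalp p)).
- have [C pC] := evalp_bounded p a b.
  exists C; split; first exact: num_real.
  by move=> M CM v Dv; exact: le_trans (pC v Dv) (ltW CM).
Qed.

Let ipE p q : ip p q = \int[omega]_(x in D) evalp (p * q) x.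
Proof. by apply: eq_Rintegral => x _; rewrite evalpM. Qed.

Lemma L2inner_evalpD p q r : ip (p + q) r = ip p r + ip q r.
Proof.
rewrite !ipE mulrDl -RintegralD//; try exact: integrable_evalp.
by apply: eq_Rintegral => x _; rewrite /evalp mpoly.mevalD.
Qed.

Lemma L2inner_evalpZ c p q : ip (c *: p) q = c * ip p q.
Proof.
rewrite !ipE -scalerAl -RintegralZl//; last exact: integrable_evalp.
by apply: eq_Rintegral => x _; rewrite /evalp mpoly.mevalZ.
Qed.

Lemma L2inner_evalpC p q : ip p q = ip q p.
Proof. by rewrite !ipE mulrC. Qed.

Lemma L2inner_ge0 (g : 'rV[R]_d -> R) : 0 <= L2inner omega D g g.
Proof. by apply: Rintegral_ge0 => x _; rewrite -expr2 sqr_ge0. Qed.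

(** If the integral of the square were zero, [p] would vanish on [D] outside an [omega]-null set. By
    absolute continuity the zero set of [p] is [omega]-null too, so [D] would be covered by two null
    sets although its mass is 1. *)
Lemma L2inner_evalp_gt0 p : p != 0 -> 0 < ip p p.
Proof.
move=> p0; rewrite lt_def L2inner_ge0 andbT; apply/eqP => pp0.
have int0 : (\int[omega]_(x in D) `|(EFin \o evalp (p * p)%R) x| = 0)%E.
  rewrite (eq_integral (EFin \o evalp (p * p))); last first.
    by move=> x _ /=; rewrite ger0_norm// evalpM -expr2 sqr_ge0.
  rewrite -[LHS]fineK; last first.
    exact: integrable_fin_num (integrable_evalp (p * p)).
  by have := ipE p p; rewrite pp0 /Rintegral => <-.
have [] := (ae_eq_integral_abs omega mD _).1 int0.
  by apply/measurable_EFinP; exact: (measurable_funS _ _ (measurable_evalp _)).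
move=> Z [mZ Z0 subZ].
have mZp := measurable_zeros p.
have Zp0 : omega [set v | evalp p v = 0] = 0%E.
  exact: ((null_content_dominatesP _ _).1 omega_ac _ mZp (zeros_null p0)).
have : (omega D <= omega ([set v | evalp p v = 0%R] `|` Z))%E.
  apply: le_measure; rewrite ?inE//; first exact: measurableU.
  move=> v Dv; have [|pv] := pselect (evalp p v = 0); first by left.
  right; apply: subZ => /= h; apply: pv; have := EFin_inj (h Dv).
  by rewrite evalpM => /eqP; rewrite mulf_eq0 orbb => /eqP.
by rewrite omegaD measureU0// [X in (_ <= X)%E]Zp0 lee_fin ler10.
Qed.

Section dim.
Context (N : nat) (V : set (mpoly.mpoly d R)) (hV : has_dim V N).

Lemma has_orthonormal_basis :
  exists psi : 'I_N -> mpoly.mpoly d R, is_orthonormal_basis omega D V psi.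
Proof.
have [beta [VE free]] := hV.
have [psi on span] := gram_schmidt L2inner_evalpD L2inner_evalpZ L2inner_evalpC
  L2inner_evalp_gt0 free.
exists psi; split=> //; split; first by rewrite VE.
move=> c c0 i.
(* Linear independence: pairing a vanishing combination with [psi i] isolates [c i]. *)
rewrite -(ip_lincomb_orthonormal L2inner_evalpD L2inner_evalpZ c i on) c0.
by have := L2inner_evalpZ 0 0 (psi i); rewrite scale0r mul0r.
Qed.

Lemma evalp_kernel_le q y : V q ->
  evalp q y ^+ 2 <= ip q q * kernel_diag omega D V N y.
Proof.
rewrite /kernel_diag; set psi := xget _ _.
(* The family chosen by [xget] is a genuine orthonormal basis, not the default zero family, because
   one exists. *)
have [[VE _] on] : is_orthonormal_basis omega D V psi.
  exact: xgetPex has_orthonormal_basis.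
rewrite VE => -[c _ <-]; rewrite evalp_lincomb.
rewrite (_ : ip _ _ = \sum_(i < N) c i ^+ 2); first exact: sum_mul_sqr_le.
rewrite (ip_lincomb L2inner_evalpD L2inner_evalpZ); apply: eq_bigr => i _.
rewrite expr2 L2inner_evalpC.
by rewrite (ip_lincomb_orthonormal L2inner_evalpD L2inner_evalpZ c i on).
Qed.

Lemma evalp_rV_kernel_le (q : 'I_d -> mpoly.mpoly d R) y : (forall l, V (q l)) ->
  enorm (evalp_rV q y) <=
  L2norm2 omega D (evalp_rV q) * Num.sqrt (kernel_diag omega D V N y).
Proof.
move=> Vq; rewrite /L2norm2 -sqrtrM; last first.
  by apply: sumr_ge0 => i _; exact: sqr_ge0.
rewrite ler_wsqrtr// mulr_suml; apply: ler_sum => l _.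
rewrite mxE sqr_sqrtr ?L2inner_ge0//.
rewrite (_ : (fun x => _) = evalp (q l)); last by apply/funext => x; rewrite mxE.
exact: evalp_kernel_le.
Qed.

Lemma has_dimB p q : V p -> V q -> V (p - q).
Proof.
have [beta [-> _]] := hV => -[c _ <-] [c' _ <-].
exists (fun i => c i - c' i) => //.
by rewrite -sumrB; apply: eq_bigr => i _; rewrite scalerBl.
Qed.

(* This also holds for the default value 0 of xget, so the existence of the
   orthogonal projection is not at stake. *)
Lemma L2proj_mem (g : 'rV[R]_d -> R) : V (L2proj omega D V g).
Proof.
rewrite /L2proj; case: xgetP => [p _ []//|_].
have [beta [-> _]] := hV; exists (fun=> 0) => //.
by rewrite big1// => i _; rewrite scale0r.
Qed.

End dim.
End kernel.

(** * Essential suprema of continuous functions *)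

Section essential_supremum.
Context {R : realType} (d : nat) (umin umax : 'rV[R]_d).
Context (humin : forall i, umin ord0 i < umax ord0 i).

Let D := box umin umax.
Let mD : measurable D := measurable_box umin umax.

(** Only lower semicontinuity relative to [D] is asked, since [f] is controlled on [D] alone. If
    [g y] exceeded the essential supremum [s], then [g] would exceed [s] on a small box of positive
    volume inside [D], which would lie in the exceptional null set. *)
Lemma le_Linfty_norm (g : 'rV[R]_d -> R) y : D y ->
  (forall e, 0 < e -> \forall z \near y, D z -> g y - e < g z) ->
  ((g y)%:E <= Linfty_norm mD g)%E.
Proof.
move=> Dy g_lsc; have := Lnorm_ge0 (mrestr (lebesgue_rV d) mD) +oo%E (EFin \o g).
(* The norm of exponent [+oo] is the essential supremum only when the total mass is positive; here
   that mass is the volume of the box. *)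
rewrite /Linfty_norm unlock ifT; last first.
  rewrite /= /mrestr setTI lebesgue_rV_box => [|i]; last exact: ltW.
  by rewrite lte_fin prodr_gt0// => i _; rewrite subr_gt0.
have := ess_sup_ge (mrestr (lebesgue_rV d) mD) (abse \o (EFin \o g)).
case: (ess_sup _ _) => [s|_ _|//]; last by rewrite leey.
move=> [Z [mZ Z0 subZ]] _; rewrite lee_fin leNgt; apply/negP => sg.
have := g_lsc (g y - s); rewrite subr_gt0 => /(_ sg).
rewrite opprB addrC subrK => /nbhs_ballP[r /= r0 ballr].
(* The corners cut [D] with a closed cube about [y]; the half-side [r / 2] keeps the cube inside the
   open sup-norm ball of radius [r]. The new box is nondegenerate even when [y] is on the boundary
   of [D]. *)
pose a := \row_i Num.max (umin ord0 i) (y ord0 i - r / 2).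
pose b := \row_i Num.min (umax ord0 i) (y ord0 i + r / 2).
have ab i : a ord0 i < b ord0 i.
  have /andP[ay yb] := Dy i; have := humin i.
  by rewrite !mxE gt_max !lt_min => ->; apply/and3P; split; lra.
have bD : box a b `<=` D.
  move=> z abz i; have := abz i; rewrite !mxE ge_max le_min.
  by move=> /andP[/andP[-> _] /andP[-> _]].
have bZ : box a b `<=` Z `&` D.
  move=> z abz; split; last exact: bD.
  apply: subZ => /=; rewrite lee_fin => gzs.
  suff : s < g z by rewrite ltNge (le_trans (ler_norm _) gzs).
  apply: ballr; last exact: bD.
  split=> // i j; rewrite ord1 /ball/=; have := abz j; rewrite !mxE ge_max le_min.
  move=> /andP[/andP[_ z1] /andP[_ z2]]; rewrite ltr_norml; apply/andP; split; lra.
have : (lebesgue_rV d (box a b) <= lebesgue_rV d (Z `&` D))%E.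
  by apply: le_measure; rewrite ?inE//; [exact: measurable_box|exact: measurableI].
rewrite [X in (_ <= X)%E]Z0 lebesgue_rV_box => [|i]; last exact: ltW.
by rewrite lee_fin leNgt prodr_gt0// => i _; rewrite subr_gt0.
Qed.

(** By the triangle inequality the norm drops by at most [h z] between [y] and [z] in [D]. The
    majorant [h] is continuous everywhere and zero at [y], whereas [f] may be discontinuous off
    [D]. *)
Lemma enorm_evalp_rV_sub_lsc (p : 'I_d -> mpoly.mpoly d R)
    (f : 'rV[R]_d -> 'rV[R]_d) (L : R) (y : 'rV[R]_d) :
  (forall u v, D u -> D v -> enorm (f u - f v) <= L * enorm (u - v)) -> D y ->
  forall e, 0 < e -> \forall z \near y, D z ->
    enorm (evalp_rV p y - f y) - e < enorm (evalp_rV p z - f z).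
Proof.
move=> lipf Dy e e0.
pose h (z : 'rV[R]_d) := enorm (evalp_rV p y - evalp_rV p z) + L * enorm (z - y).
have h_cont : continuous h.
  move=> z; apply: (@continuousD _ _ _
    (fun z : 'rV[R]_d => enorm (evalp_rV p y - evalp_rV p z))
    (fun z : 'rV[R]_d => L * enorm (z - y))); last first.
    apply: continuousM; first exact: cst_continuous.
    apply: enorm_comp_continuous => i {}z.
    rewrite (_ : (fun _ => _) = fun z : 'rV[R]_d => z ord0 i - y ord0 i); last first.
      by apply/funext => w; rewrite !mxE.
    by apply: (@continuousB _ _ _ (fun z : 'rV[R]_d => z ord0 i) (cst (y ord0 i)));
      [exact: coord_continuous|exact: cst_continuous].
  apply: enorm_comp_continuous => i {}z.
  rewrite (_ : (fun _ => _) = fun z => evalp (p i) y - evalp (p i) z); last first.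
    by apply/funext => w; rewrite !mxE.
  by apply: (@continuousB _ _ _ (cst (evalp (p i) y)) (evalp (p i)));
    [exact: cst_continuous|exact: evalp_continuous].
have hy0 : h y = 0 by rewrite /h !subrr enorm0 mulr0 addr0.
have : \forall z \near y, h z < e.
  by apply: (@cvgr_lt _ _ _ _ h _ (h_cont y)); rewrite hy0.
apply: filterS => z hze Dz; rewrite ltrBlDr.
rewrite (le_lt_trans (y := enorm (evalp_rV p z - f z) + h z))//; last first.
  by rewrite ltrD2l.
rewrite (_ : evalp_rV p y - f y = (evalp_rV p z - f z)
  + ((evalp_rV p y - evalp_rV p z) + (f z - f y))); last first.
  by rewrite addrC [in RHS]addrACA addrCA; apply/rowP => i; rewrite !mxE; ring.
rewrite (le_trans (enormD _ _))// lerD2l (le_trans (enormD _ _))// lerD2l.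
exact: lipf.
Qed.

End essential_supremum.

(** * Continuity of the kernel and proof of the two estimates *)

Lemma kernel_diag_sqrt_continuous (R : realType) (d : nat)
    (omega : probability 'rV[R]_d R) (D : set 'rV[R]_d)
    (V : set (mpoly.mpoly d R)) (N : nat) :
  continuous (fun y => Num.sqrt (kernel_diag omega D V N y)).
Proof.
move=> y; apply: (@continuous_comp _ _ _ (@kernel_diag R d omega D V N) Num.sqrt).
  move: y; apply: sum_continuous => j y.
  apply: (@continuous_comp _ _ _ (evalp _) (fun r : R => r ^+ 2));
    [exact: evalp_continuous|exact: exprn_continuous].
exact: sqrt_continuous.
Qed.

Theorem theorem1 (R : realType) (d : nat) (hd : (1 <= d)%N)
  (umin umax : 'rV[R]_d) (humin : forall i, umin ord0 i < umax ord0 i)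
  (omega : probability 'rV[R]_d R)
  (homegaD : omega (box umin umax) = 1%E)
  (homega_ac : omega `<< lebesgue_rV d)
  (N : nat) (hN : (1 <= N)%N)
  (V : set (mpoly.mpoly d R)) (hV : has_dim V N)
  (f : 'rV[R]_d -> 'rV[R]_d) (Lf : R) (hLf : 0 < Lf)
  (hf : forall u1 u2, box umin umax u1 -> box umin umax u2 ->
        enorm (f u1 - f u2) <= Lf * enorm (u1 - u2))
  (ftilde : 'I_d -> mpoly.mpoly d R) (hftilde : forall l, V (ftilde l))
  (t0 T : R) (ht : t0 <= T) (u x : R -> 'rV[R]_d)
  (hu : ode_solution f t0 T u)
  (hx : ode_solution (evalp_rV ftilde) t0 T x)
  (hxu0 : x t0 = u t0)
  (huD : forall t, t0 <= t <= T -> box umin umax (u t))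
  (hxD : forall t, t0 <= t <= T -> box umin umax (x t)) :
  forall t, t0 <= t <= T ->
  ((enorm (x t - u t))%:E <=
     (t - t0)%:E *
       Linfty_norm2 (measurable_box umin umax) (evalp_rV ftilde \- f)%R
     + (Lf * \int[lebesgue_measure]_(s in `[t0, t]) enorm (x s - u s))%:E)%E
  /\
  ((enorm (x t - u t))%:E <=
     (Lf^-1 * (expR (Lf * (t - t0)) - 1))%:E *
     (Linfty_norm2 (measurable_box umin umax)
        (f \- L2proj_rV omega (box umin umax) V f)%R
      + (L2norm2 omega (box umin umax)
           (evalp_rV ftilde \- L2proj_rV omega (box umin umax) V f)%R)%:E
        * Linfty_norm (measurable_box umin umax)
            (fun y => Num.sqrt
               (kernel_diag omega (box umin umax) V N y))))%E.
Proof.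
move=> t tT; set D := box umin umax; set mD := measurable_box umin umax.
have t0t : t0 <= t by case/andP: tT.
have enorm_t0 : t = t0 -> enorm (x t - u t) = 0.
  by move=> ->; rewrite hxu0 subrr enorm0.
have lt0t : t != t0 -> t0 < t by move=> tneq; rewrite lt_def tneq.
have Linfty_ge p y : D y ->
    ((enorm (evalp_rV p y - f y))%:E <= Linfty_norm2 mD (evalp_rV p \- f)%R)%E.
  move=> Dy; apply: (le_Linfty_norm humin Dy) => e e0.
  exact: enorm_evalp_rV_sub_lsc hf Dy _ e0.
split.
  set X := Linfty_norm2 _ _.
  have X0 : (0 <= X)%E by exact: Lnorm_ge0.
  have int0 : 0 <= Lf * \int[lebesgue_measure]_(s in `[t0, t]) enorm (x s - u s).
    by rewrite mulr_ge0 ?(ltW hLf)// Rintegral_ge0// => s _; exact: enorm_ge0.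
  (* An infinite norm makes the right-hand side infinite only for [t > t0]. At [t = t0] the product
     of 0 and [+oo] is 0, and the inequality holds because the left-hand side vanishes. The second
     estimate is treated in the same way. *)
  have [XE|Xoo] := eqVneq X +oo%E.
    have [/enorm_t0 ->|/lt0t tt] := eqVneq t t0.
      by rewrite adde_ge0 ?mule_ge0 ?lee_fin ?subr_ge0.
    by rewrite XE gt0_muley ?lte_fin ?subr_gt0// addye// leey.
  have Xfin : X \is a fin_num by rewrite ge0_fin_numE// ltey.
  rewrite -(fineK Xfin) -EFinM -EFinD lee_fin (mulrC (t - t0)).
  apply: (ode_integral_ineq hLf hf _ hu hx) => // y Dy.
  by rewrite -lee_fin fineK//; exact: Linfty_ge.
set Q := L2norm2 _ _ _; set A := Linfty_norm2 _ _; set kappa := Linfty_norm _ _.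
have Q0 : 0 <= Q by exact: sqrtr_ge0.
have exp0 : 0 <= Lf^-1 * (expR (Lf * (t - t0)) - 1).
  rewrite mulr_ge0 ?invr_ge0 ?(ltW hLf)// subr_ge0 -expR0 ler_expR.
  by rewrite mulr_ge0 ?(ltW hLf) ?subr_ge0.
set X := (A + Q%:E * kappa)%E.
have X0 : (0 <= X)%E.
  by rewrite adde_ge0 ?mule_ge0 ?lee_fin//; exact: Lnorm_ge0.
have [XE|Xoo] := eqVneq X +oo%E.
  have [/enorm_t0 ->|/lt0t tt] := eqVneq t t0; first by rewrite mule_ge0.
  rewrite XE gt0_muley ?leey// lte_fin mulr_gt0 ?invr_gt0// subr_gt0.
  by rewrite -[ltLHS]expR0 ltr_expR mulr_gt0 ?subr_gt0.
have Xfin : X \is a fin_num by rewrite ge0_fin_numE// ltey.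
rewrite -(fineK Xfin) -EFinM lee_fin mulrC mulrA.
(* Gronwall's bound is applied with the finite value of [X] as [M]; it remains to bound the defect
   pointwise on [D]. *)
apply: (ode_gronwall hLf hf _ hu hx) => // y Dy.
rewrite -lee_fin fineK//.
pose P l := L2proj omega D V (fun x => f x ord0 l).
have PE : L2proj_rV omega D V f = evalp_rV P by [].
pose q l := ftilde l - P l.
have qE : evalp_rV q = (evalp_rV ftilde \- evalp_rV P)%R.
  by apply/funext => z; apply/rowP => l; rewrite !mxE evalpB.
have Vq l : V (q l).
  by apply: (has_dimB hV) => //; exact: (L2proj_mem _ _ _ hV).
(* The defect splits at the projection: the first term is bounded by its essential supremum, and the
   second has its components in [V], so the kernel bound applies. *)
have -> : evalp_rV ftilde y - f y = (evalp_rV P y - f y) + evalp_rV q y.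
  by rewrite qE [RHS]addrC /= addrA subrK.
apply: le_trans (_ : (enorm (evalp_rV P y - f y))%:E + (enorm (evalp_rV q y))%:E <= _)%E.
  by rewrite -EFinD lee_fin enormD.
apply: leeD.
  rewrite /A PE (_ : Linfty_norm2 _ _ = Linfty_norm2 mD (evalp_rV P \- f)%R).
    exact: Linfty_ge.
  congr Lnorm; apply/funext => z /=.
  by rewrite -enormN opprB.
apply: (@le_trans _ _ (Q%:E * (Num.sqrt (kernel_diag omega D V N y))%:E)%E).
  rewrite -EFinM lee_fin /Q PE -qE.
  exact: (evalp_rV_kernel_le homegaD homega_ac hV).
apply: lee_wpmul2l; first by rewrite lee_fin.
apply: (le_Linfty_norm humin Dy) => e e0.
have := @kernel_diag_sqrt_continuous R d omega D V N y.
move=> /cvgr_gt/(_ (Num.sqrt (kernel_diag omega D V N y) - e)).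
rewrite ltrBlDr ltrDl => /(_ e0).
by apply: filterS => z hz _.
Qed.
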